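(* Let $0<p_i<\infty$ and $\varphi_i\in\mathcal{G}_{p_i}(\mathbb{D})$ with $\varphi_i(1)=1$, $i=1,2$. Let $\varrho=\min\{1,\frac{p_1}{p_2}\}$. Assume $\sup_{k\in\mathbb{N}_0}\varphi_i(2^k)=\infty$, $i=1,2$. Then the embedding $$m_{\varphi_1,p_1}\hookrightarrow m_{\varphi_2,p_2}$$ is continuous (i.e. $m_{\varphi_1,p_1}\subset m_{\varphi_2,p_2}$ and the inclusion map is bounded) if, and only if, $$\sup_{j\in\mathbb{N}_0}\frac{\varphi_2(2^j)}{\varphi_1(2^j)^{\varrho}}<\infty.$$ The embedding is never compact.
   Context: Let $d\geq 1$ be an integer and $\mathbb{N}_0=\{0,1,2,\dots\}$. Dyadic cubes: $Q_{j,k}=2^{-j}([0,1)^d+k)$ for $j\in\mathbb{Z}$, $k\in\mathbb{Z}^d$; in particular $Q_{-j,m}=2^j([0,1)^d+m)$. For a cube $Q$, $\ell(Q)$ is its side length and $|Q|=\ell(Q)^d$. Put $\mathbb{D}=\{2^j: j\in\mathbb{N}_0\}$. For $0<p<\infty$ and $\varphi:\mathbb{D}\to[0,\infty)$ not identically zero, $m_{\varphi,p}=m_{\varphi,p}(\mathbb{Z}^d)$ is the space of all complex sequences $\lambda=\{\lambda_k\}_{k\in\mathbb{Z}^d}$ with finite (quasi-)norm $$\|\lambda|m_{\varphi,p}\|=\sup_{j\in\mathbb{N}_0,\,m\in\mathbb{Z}^d}\frac{\varphi(\ell(Q_{-j,m}))}{|Q_{-j,m}|^{1/p}}\Big(\sum_{k:\,Q_{0,k}\subset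 Q_{-j,m}}|\lambda_k|^p\Big)^{1/p}.$$ $\mathcal{G}_p(\mathbb{D})$ is the set of all $\varphi:\mathbb{D}\to(0,\infty)$ with $1\leq\frac{\varphi(2^k)}{\varphi(2^j)}\leq 2^{(k-j)d/p}$ for all $j\leq k$, $j,k\in\mathbb{N}_0$. *)

(* Defs.v *)
From HB Require Import structures.
From mathcomp Require Import all_boot all_order all_algebra.
From mathcomp Require Import all_classical all_reals all_analysis.
From mathcomp Require Import complex.

Set Implicit Arguments.
Unset Strict Implicit.
Unset Printing Implicit Defensive.

Import Order.TTheory GRing.Theory Num.Theory.

Local Open Scope classical_set_scope.
Local Open Scope ring_scope.

Section DyadicCubes.
Context {R : realType} (d : nat).

Definition dyadic_cube (j : int) (k : 'rV[int]_d) : set 'rV[R]_d :=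
  [set (2 ^ (- j) : R) *: (x + map_mx intr k) |
     x in [set x : 'rV[R]_d | forall i, 0 <= x ord0 i < 1]].

(* side length and volume of [dyadic_cube j k]; they do not depend on [k] *)
Definition dyadic_side (j : int) : R := 2 ^ (- j).
Definition dyadic_volume (j : int) : R := dyadic_side j ^+ d.

End DyadicCubes.

Definition dyadic {R : realType} : set R := [set 2 ^+ j | j in [set: nat]].

(* A function on the set [dyadic] is represented by a function on [R] of which
   only the values at the points of [dyadic] are ever used. *)
Definition classG {R : realType} (d : nat) (p : R) : set (R -> R) :=
  [set phi | (forall t, dyadic t -> 0 < phi t) /\
    forall j k : nat, (j <= k)%N ->
      1 <= phi (2 ^+ k) / phi (2 ^+ j) <= 2 `^ ((k - j)%:R * d%:R / p)].

Section MorreySequences.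
Context {R : realType} {d : nat}.
Implicit Types (phi : R -> R) (p : R) (lam : 'rV[int]_d -> R[i]).

Definition mnorm phi p lam : \bar R :=
  ereal_sup
    [set ((phi (dyadic_side (- j%:Z)) / dyadic_volume d (- j%:Z) `^ p^-1)%:E *
          (\esum_(k in [set k | @dyadic_cube R d 0 k `<=` dyadic_cube (- j%:Z) m])
             (Normc.normc (lam k) `^ p)%:E) `^ p^-1)%E
    | j in [set: nat] & m in [set: 'rV[int]_d]].

Definition mspace phi p : set ('rV[int]_d -> R[i]) :=
  [set lam | (mnorm phi p lam < +oo)%E].

Definition mseq phi p : Type := set_type (mspace phi p).

Definition mseq_norm phi p (x : mseq phi p) : \bar R := mnorm phi p (\val x).

(* Topology of the quasi-norm: a set is open when it contains, around each of
   its points, a quasi-norm ball (quasi-norm balls themselves need not be open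
   when p < 1). *)
Definition mseq_open phi p (U : set (mseq phi p)) : Prop :=
  forall x, U x -> exists2 e : R, 0 < e &
    forall y : mseq phi p, (mnorm phi p (\val y - \val x)%R < e%:E)%E -> U y.

Lemma mseq_openT phi p : mseq_open (setT : set (mseq phi p)).
Proof. by move=> x _; exists 1. Qed.

Lemma mseq_openI phi p : setI_closed (@mseq_open phi p).
Proof.
move=> A B oA oB x [/oA[e e0 eA] /oB[f f0 fB]].
exists (Num.min e f); first by rewrite lt_min e0.
by move=> y; rewrite EFin_min lt_min => /andP[/eA ? /fB].
Qed.

Lemma mseq_open_bigU phi p (I : Type) (f : I -> set (mseq phi p)) :
  (forall i, mseq_open (f i)) -> mseq_open (\bigcup_i f i).
Proof.
move=> of_ x [i _ /of_[e e0 ef]]; exists e => // y /ef fy.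
by exists i.
Qed.

HB.instance Definition _ phi p :=
  Choice.copy (mseq phi p) (set_type (mspace phi p)).

HB.instance Definition _ phi p :=
  isOpenTopological.Build (mseq phi p)
    (@mseq_openT phi p) (@mseq_openI phi p) (@mseq_open_bigU phi p).

Section Embedding.
Variables (phi1 phi2 : R -> R) (p1 p2 : R).

Definition minclusion (sub : mspace phi1 p1 `<=` mspace phi2 p2)
    (x : mseq phi1 p1) : mseq phi2 p2 :=
  SigSub (mem_set (sub (\val x) (set_mem (valP x)))).

Definition continuous_embedding : Prop :=
  exists (sub : mspace phi1 p1 `<=` mspace phi2 p2) (C : R),
    forall x, (mseq_norm (minclusion sub x) <= C%:E * mseq_norm x)%E.

Definition compact_embedding : Prop :=
  exists sub : mspace phi1 p1 `<=` mspace phi2 p2,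
    precompact (minclusion sub @` [set x | (mseq_norm x <= 1)%E]).

End Embedding.
End MorreySequences.

Arguments continuous_embedding {R} d phi1 phi2 p1 p2.
Arguments compact_embedding {R} d phi1 phi2 p1 p2.

(* Main.v *)
Require Import Defs.
From mathcomp Require Import all_boot all_order all_algebra.
From mathcomp Require Import all_classical all_reals all_analysis.
From mathcomp Require Import complex.
From mathcomp Require Import zify ring lra.

Import Order.TTheory GRing.Theory Num.Theory.

Local Open Scope classical_set_scope.
Local Open Scope ring_scope.

(** The cube [Q_{-j,m}] contains [2 ^ (j d)] unit cubes, so the norm of [lam] is
    the supremum over [j] and [m] of [phi (2 ^ j)] times the [p]-th power mean
    of [|lam|] over these unit cubes ([mnormE]).  Write [rho] for
    [min 1 (p1 / p2)].

    Growth condition implies embedding ([mnorm_embedding]).  If [p2 <= p1], power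
    means increase with the exponent ([pmean_le_exponent]), which gives the
    bound at once.  If [p1 < p2], the cubes with [j = 0] and [phi1 1 = 1] bound every
    [|lam k|] by the norm [N] of [lam], and interpolating between this bound and
    the [p1]-mean ([pmean_interpolation]) bounds the [p2]-mean on a cube of side
    [2 ^ j] by [N / phi1 (2 ^ j) ^ rho].

    Embedding implies growth condition ([growth_of_embedding]).  The test
    sequences are the indicators of the points of [2 ^ s Z ^ d] in [Q_{-j,m}],
    for [s <= j].  On a cube of side [2 ^ J] such a comb has at most
    [2 ^ (d (min J j - s))] points, with truncated subtraction
    ([card_comb_le]).  Hence its norm is at most
    [max 1 (phi (2 ^ j) / 2 ^ (s d / p))] ([mnorm_comb_le]), while [Q_{-j,m}]
    alone contributes [phi (2 ^ j) / 2 ^ (s d / p)] ([mnorm_comb_ge]).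
    For [p2 <= p1] the full cube, [s = 0], gives the condition.  For [p1 < p2]
    the best comb is the densest one of norm at most 1 in the source space:
    the least [s] with [phi1 (2 ^ j) <= 2 ^ (s d / p1)].  Minimality of [s] makes
    [2 ^ (s d / p2)] at most a constant times [phi1 (2 ^ j) ^ rho].

    Failure of compactness ([not_compact_embedding]).  The unit sequences,
    which are the combs with [s = j = 0], lie in the unit ball of the source
    and are at mutual distance 1 in the supremum norm.  The target norm
    dominates the supremum norm, so balls of the latter are neighbourhoods in
    the target and no point is a cluster point of the unit sequences. *)

(** * Dyadic cubes and their unit subcubes *)

(** [cell j m] enumerates the positions of the unit cubes in [Q_{-j,m}] by a
    finite type, so that the sums in the norm become finite sums over it. *)
Definition cell {d : nat} (j : nat) (m : 'rV[int]_d)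
    (t : {ffun 'I_d -> 'I_(2 ^ j)}) : 'rV[int]_d :=
  \row_i (m ord0 i * 2 ^+ j + (t i)%:Z).

Lemma cell_inj {d : nat} (j : nat) (m : 'rV[int]_d) : injective (cell j m).
Proof.
move=> t t' /rowP e; apply/ffunP => i; apply: val_inj.
by move: (e i); rewrite !mxE => /addrI [].
Qed.

Lemma cellP {d : nat} (j : nat) (m k : 'rV[int]_d) :
  (exists t, cell j m t = k) <->
  forall i, m ord0 i * 2 ^+ j <= k ord0 i < (m ord0 i + 1) * 2 ^+ j.
Proof.
have p2 : (2 ^+ j : int) = (2 ^ j)%N by rewrite -natrX natz.
split=> [[t <-] i|h].
  rewrite mxE p2; have := ltn_ord (t i); lia.
have lt_t i : (absz (k ord0 i - m ord0 i * 2 ^+ j)%R < 2 ^ j)%N.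
  by have := h i; rewrite p2; lia.
exists [ffun i => Ordinal (lt_t i)]; apply/rowP => i.
rewrite !mxE ffunE /= -[k 0 i]/(k ord0 i); have := h i; rewrite p2; lia.
Qed.

Lemma dyadic_cubeP {R : realType} {d : nat} (j : nat) (m : 'rV[int]_d)
    (y : 'rV[R]_d) :
  dyadic_cube (- j%:Z) m y <->
  forall i, (m ord0 i)%:~R * 2 ^+ j <= y ord0 i < ((m ord0 i)%:~R + 1) * 2 ^+ j.
Proof.
rewrite /dyadic_cube opprK -exprnP.
have p2 : (0 : R) < 2 ^+ j by rewrite exprn_gt0.
split=> [[x x01 <-] i|h].
  have /andP[x0 x1] := x01 i.
  by rewrite !mxE [2 ^+ j * _]mulrC ler_pM2r// ltr_pM2r// lerDr x0 addrC ltrD2l.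
exists ((2 ^+ j)^-1 *: y - map_mx intr m) => [i|]; last first.
  by rewrite subrK scalerA divff ?scale1r// gt_eqF.
rewrite !mxE subr_ge0 ltrBlDr [_^-1 * _]mulrC ler_pdivlMr// ltr_pdivrMr//.
by rewrite [1 + _]addrC; exact: h.
Qed.

Lemma dyadic_cube_subsetP {R : realType} {d : nat} (j : nat) (m k : 'rV[int]_d) :
  @dyadic_cube R d 0 k `<=` dyadic_cube (- j%:Z) m <-> exists t, cell j m t = k.
Proof.
rewrite cellP; split=> [sub i|h y].
  have /sub /dyadic_cubeP /(_ i) : @dyadic_cube R d (- 0%:Z) k (map_mx intr k).
    by apply/dyadic_cubeP => i'; rewrite !mxE expr0 !mulr1 lexx ltrDl/=.
  by rewrite mxE -[2]/(2%:~R) -[1]/(1%:~R) -rmorphXn -rmorphD -!rmorphM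
     ler_int ltr_int.
move/(@dyadic_cubeP R d 0) => yk; apply/dyadic_cubeP => i.
have /andP[mk km] := h i; have /andP[ky yk1] := yk i.
rewrite expr0 !mulr1 in ky yk1.
apply/andP; split.
  apply: le_trans ky.
  by rewrite -[2]/(2%:~R) -rmorphXn -rmorphM ler_int.
apply: lt_le_trans yk1 _.
by rewrite -[2]/(2%:~R) -[1]/(1%:~R) -rmorphXn -!rmorphD -!rmorphM ler_int lezD1.
Qed.

Lemma card_cell (d n : nat) : #|{: {ffun 'I_d -> 'I_n}}| = (n ^ d)%N.
Proof. by rewrite card_ffun !card_ord. Qed.

(** * Power means *)

Lemma powRV {R : realType} (x r : R) : 0 < x -> x^-1 `^ r = (x `^ r)^-1.
Proof.
move=> x0; have xr0 : x `^ r != 0 by rewrite gt_eqF// powR_gt0.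
apply: (mulIf xr0); rewrite mulVf// -powRM ?invr_ge0 ?ltW//.
by rewrite mulVf ?gt_eqF// powR1.
Qed.

Definition pmean {R : realType} {T : finType} (p : R) (f : T -> R) : R :=
  (#|T|%:R^-1 * \sum_t f t `^ p) `^ p^-1.

Lemma pmean_ge0 {R : realType} {T : finType} (p : R) (f : T -> R) :
  0 <= pmean p f.
Proof. exact: powR_ge0. Qed.

Lemma mean_powR_ge0 {R : realType} {T : finType} (p : R) (f : T -> R) :
  0 <= #|T|%:R^-1 * \sum_t f t `^ p.
Proof. by rewrite mulr_ge0 ?invr_ge0// sumr_ge0// => t _; exact: powR_ge0. Qed.

(** Jensen's inequality for the power [r = p / q], obtained by applying Young's
    inequality to [f t ^ q] and [B ^ (r - 1)], where [B] is the mean of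
    [f ^ q], and averaging over [t]. *)
Lemma pmean_le_exponent {R : realType} {T : finType} (q p : R) (f : T -> R) :
  0 < q -> q <= p -> pmean q f <= pmean p f.
Proof.
move=> q0; rewrite le_eqVlt => /orP[/eqP <-//|qp].
have p0 : 0 < p by exact: lt_trans qp.
pose r := p / q; have r1 : 1 < r by rewrite ltr_pdivlMr// mul1r.
have r0 : 0 < r by exact: lt_trans r1.
pose B := #|T|%:R^-1 * \sum_t f t `^ q.
pose M := #|T|%:R^-1 * \sum_t f t `^ p.
have B0 : 0 <= B by exact: mean_powR_ge0.
have qr : q * r = p by rewrite /r mulrCA divff ?mulr1// gt_eqF.
suff BM : B `^ r <= M.
  rewrite /pmean -/B -/M.
  have -> : q^-1 = r * p^-1 by rewrite /r; field; rewrite !gt_eqF.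
  rewrite powRrM; apply: ge0_ler_powR => //.
  - by rewrite invr_ge0 ltW.
  - by rewrite nnegrE powR_ge0.
  - by rewrite nnegrE; exact: mean_powR_ge0.
have [/eqP T0|T0] := eqVneq #|T| 0%N.
  rewrite /B /M; move/eqP: T0 => ->.
  by rewrite invr0 !mul0r powR0// gt_eqF.
have c0 : (#|T|%:R : R) != 0 by rewrite pnatr_eq0.
pose r' := r / (r - 1).
have r'0 : 0 < r' by rewrite divr_gt0// subr_gt0.
have rr' : r^-1 + r'^-1 = 1.
  by rewrite /r'; field; rewrite !gt_eqF// subr_gt0.
have young t : f t `^ q * B `^ (r - 1) <= f t `^ p / r + B `^ r / r'.
  have -> : f t `^ p = (f t `^ q) `^ r by rewrite -powRrM qr.
  have -> : B `^ r = (B `^ (r - 1)) `^ r'.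
    rewrite -powRrM; congr (_ `^ _).
    by rewrite /r' mulrCA divff ?mulr1// gt_eqF// subr_gt0.
  by apply: conjugate_powR => //; exact: powR_ge0.
have : B `^ r <= M / r + B `^ r / r'.
  have {1}-> : r = 1 + (r - 1) by ring.
  rewrite powRD; last by rewrite addrC subrK gt_eqF.
  rewrite powRr1// {1}/B /M -mulrA mulr_suml.
  have -> : B `^ r / r' = #|T|%:R^-1 * \sum_(t : T) (B `^ r / r').
    by rewrite sumr_const -[(_ / r') *+ _]mulr_natl mulrA mulVf// mul1r.
  rewrite -mulrA -mulrDr mulr_suml -big_split/=.
  by apply: ler_wpM2l; [rewrite invr_ge0|apply: ler_sum => t _; exact: young].
have -> : r'^-1 = 1 - r^-1 by rewrite -rr' addrAC subrr add0r.
by rewrite mulrBr mulr1 addrCA lerDl subr_ge0 ler_pM2r ?invr_gt0.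
Qed.

(** Interpolation between exponents [p] and infinity: pointwise,
    [f ^ q <= N ^ (q - p) * f ^ p]. *)
Lemma pmean_interpolation {R : realType} {T : finType} (p q N : R) (f : T -> R) :
  0 < p -> p < q -> (forall t, 0 <= f t <= N) ->
  pmean q f <= N `^ (1 - p / q) * pmean p f `^ (p / q).
Proof.
move=> p0 pq fN; have q0 : 0 < q by exact: lt_trans pq.
pose A := #|T|%:R^-1 * \sum_t f t `^ p.
have A0 : 0 <= A by exact: mean_powR_ge0.
have -> : N `^ (1 - p / q) * pmean p f `^ (p / q) = (N `^ (q - p) * A) `^ q^-1.
  rewrite powRM ?powR_ge0// -!powRrM; congr (_ `^ _ * _ `^ _).
    by field; rewrite gt_eqF.
  by field; rewrite !gt_eqF.
apply: ge0_ler_powR; rewrite ?invr_ge0 ?(ltW q0) ?nnegrE//.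
- exact: mean_powR_ge0.
- by rewrite mulr_ge0 ?powR_ge0.
rewrite /A mulrCA; apply: ler_wpM2l; first by rewrite invr_ge0.
rewrite mulr_sumr; apply: ler_sum => t _; have /andP[f0 fle] := fN t.
have {1}-> : q = (q - p) + p by rewrite subrK.
rewrite powRD; last by rewrite subrK gt_eqF.
apply: ler_wpM2r; first exact: powR_ge0.
by apply: ge0_ler_powR; rewrite ?nnegrE ?subr_ge0 ?(ltW pq)// (le_trans f0).
Qed.

Lemma pmean_cst {R : realType} {T : finType} (p x : R) :
  0 < p -> #|T| != 0%N -> 0 <= x -> pmean p (fun _ : T => x) = x.
Proof.
move=> p0 T0 x0; rewrite /pmean sumr_const -[(x `^ p) *+ _]mulr_natl mulrA.
by rewrite mulVf ?pnatr_eq0// mul1r -powRrM divff ?powRr1// gt_eqF.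
Qed.

(** * Volume factors and growth functions *)

(** The normalising factor [|Q| ^ (1 / p)] of a cube [Q] of side [2 ^ n]. *)
Definition volroot {R : realType} (d : nat) (p : R) (n : nat) : R :=
  2 `^ (n%:R * d%:R / p).

Section Volroot.
Context {R : realType} (d : nat) (p : R).
Implicit Types m n : nat.

Lemma volroot_gt0 n : 0 < volroot d p n. Proof. exact: powR_gt0. Qed.

Lemma volroot0 : volroot d p 0 = 1.
Proof. by rewrite /volroot !mul0r powRr0. Qed.

Lemma volrootD m n : volroot d p (m + n) = volroot d p m * volroot d p n.
Proof.
rewrite /volroot natrD !mulrDl powRD//.
by rewrite implybE pnatr_eq0 orbT.
Qed.

Lemma volrootE n : volroot d p n = ((2 ^ n) ^ d)%:R `^ p^-1.
Proof.
by rewrite /volroot powRrM -natrM powR_mulrn// -natrX expnM.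
Qed.

Lemma volroot_ge1 n : 0 < p -> 1 <= volroot d p n.
Proof.
move=> p0; rewrite -[leLHS](@powRr0 _ 2); apply: ler_powR; first by rewrite ler1n.
by rewrite divr_ge0 ?(ltW p0)// mulr_ge0.
Qed.

Lemma volroot_subn m n : (n <= m)%N ->
  volroot d p (m - n) = volroot d p m / volroot d p n.
Proof.
move=> nm; rewrite -[in RHS](subnK nm) volrootD mulfK// gt_eqF//.
exact: volroot_gt0.
Qed.

End Volroot.

Lemma volroot_powR {R : realType} (d : nat) (p q : R) (n : nat) :
  0 < p -> volroot d q n = volroot d p n `^ (p / q).
Proof.
move=> p0; rewrite /volroot -powRrM mulrA divfK ?gt_eqF//.
Qed.

Section ClassG.
Context {R : realType} (d : nat) (p : R) (phi : R -> R).
Hypothesis phiG : classG d p phi.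

Lemma classG_gt0 j : 0 < phi (2 ^+ j).
Proof. by apply: phiG.1; exists j. Qed.

Lemma classG_le j k : (j <= k)%N -> phi (2 ^+ j) <= phi (2 ^+ k).
Proof.
by move=> /phiG.2 /andP[+ _]; rewrite ler_pdivlMr ?classG_gt0// mul1r.
Qed.

Lemma classG_ge1 j : phi 1 = 1 -> 1 <= phi (2 ^+ j).
Proof. by move=> phi1; rewrite -[leLHS]phi1; exact: (@classG_le 0%N). Qed.

Lemma classG_volroot j k : (j <= k)%N ->
  phi (2 ^+ k) <= phi (2 ^+ j) * volroot d p (k - j).
Proof.
by move=> /phiG.2 /andP[_]; rewrite ler_pdivrMr ?classG_gt0// mulrC.
Qed.

End ClassG.

Arguments classG_gt0 {R d p phi} phiG j.
Arguments classG_le {R d p phi} phiG {j k}.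
Arguments classG_ge1 {R d p phi} phiG j.
Arguments classG_volroot {R d p phi} phiG {j k}.

(** * The norm as a supremum of power means *)

Definition cell_mean {R : realType} {d : nat} (p : R) (lam : 'rV[int]_d -> R[i])
    (j : nat) (m : 'rV[int]_d) : R :=
  pmean p (fun t => Normc.normc (lam (cell j m t))).

Lemma esum_cell {R : realType} {d : nat} (j : nat) (m : 'rV[int]_d)
    (f : 'rV[int]_d -> R) : (forall k, 0 <= f k) ->
  \esum_(k in [set k | @dyadic_cube R d 0 k `<=` dyadic_cube (- j%:Z) m])
     (f k)%:E = (\sum_t f (cell j m t))%:E.
Proof.
move=> f0; rewrite (@reindex_esum _ _ _ setT _ (cell j m)); last first.
  split=> [t _|t t' _ _|k /dyadic_cube_subsetP[t <-]].
  - by apply/dyadic_cube_subsetP; exists t.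
  - exact: cell_inj.
  - by exists t.
rewrite esum_fset => [|//|t _]; last by rewrite lee_fin.
rewrite -sumEFin [RHS]bigfs ?index_enum_uniq ?set_true// => t _.
by rewrite mem_index_enum.
exact: finite_finset.
Qed.

(** The prefactor [|Q| ^ (- 1 / p)] and the sum over the cube combine into a
    power mean, because [|Q|] is the number of unit cubes in [Q]. *)
Lemma mnormE {R : realType} {d : nat} (phi : R -> R) (p : R)
    (lam : 'rV[int]_d -> R[i]) :
  mnorm phi p lam =
  ereal_sup [set (phi (2 ^+ j) * cell_mean p lam j m)%:E
            | j in [set: nat] & m in [set: 'rV[int]_d]].
Proof.
congr (ereal_sup (image2 _ _ _)); apply/funext => j; apply/funext => m.
rewrite esum_cell => [|k]; last exact: powR_ge0.
rewrite poweR_EFin -EFinM /dyadic_volume /dyadic_side opprK -exprnP.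
rewrite /cell_mean /pmean card_cell natrX natrX.
rewrite powRM ?invr_ge0 ?sumr_ge0// => [|t _]; last exact: powR_ge0.
by rewrite powRV ?mulrA// !exprn_gt0.
Qed.

Lemma mnorm_leP {R : realType} {d : nat} (phi : R -> R) (p M : R)
    (lam : 'rV[int]_d -> R[i]) :
  (mnorm phi p lam <= M%:E)%E <->
  forall j m, phi (2 ^+ j) * cell_mean p lam j m <= M.
Proof.
rewrite mnormE; split=> [/ereal_supP h j m|h].
  by rewrite -lee_fin; apply: h; exists j => //; exists m.
by apply/ereal_supP => _ [j _ [m _ <-]]; rewrite lee_fin.
Qed.

Lemma mnorm_ge {R : realType} {d : nat} (phi : R -> R) (p : R)
    (lam : 'rV[int]_d -> R[i]) (j : nat) (m : 'rV[int]_d) :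
  ((phi (2 ^+ j) * cell_mean p lam j m)%:E <= mnorm phi p lam)%E.
Proof. by rewrite mnormE; apply: ereal_sup_ubound; exists j => //; exists m. Qed.

Lemma mnorm_ge0 {R : realType} {d : nat} (phi : R -> R) (p : R)
    (lam : 'rV[int]_d -> R[i]) : 0 <= phi 1 -> (0 <= mnorm phi p lam)%E.
Proof.
move=> phi0; apply: le_trans (mnorm_ge phi p lam 0 0).
by rewrite lee_fin mulr_ge0 ?pmean_ge0.
Qed.

Lemma normc_ge0 {R : realType} (z : R[i]) : 0 <= Normc.normc z.
Proof. by case: z => a b; exact: sqrtr_ge0. Qed.

Lemma cell0 {d : nat} (k : 'rV[int]_d) (t : {ffun 'I_d -> 'I_(2 ^ 0)}) :
  cell 0 k t = k.
Proof.
apply/rowP => i; rewrite mxE mulr1 -[k 0 i]/(k ord0 i).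
by case: (t i) => -[]//= _; rewrite addr0.
Qed.

(** The cubes of side 1 make every space of the scale embed into the bounded
    sequences, with constant 1. *)
Lemma normc_le_mnorm {R : realType} {d : nat} (phi : R -> R) (p : R)
    (lam : 'rV[int]_d -> R[i]) (k : 'rV[int]_d) : 0 < p -> phi 1 = 1 ->
  ((Normc.normc (lam k))%:E <= mnorm phi p lam)%E.
Proof.
move=> p0 phi1; apply: le_trans (mnorm_ge phi p lam 0 k).
rewrite lee_fin phi1 mul1r /cell_mean.
under [X in pmean _ X]eq_fun do rewrite cell0.
by rewrite pmean_cst ?normc_ge0// card_cell -lt0n !expn_gt0.
Qed.

(** Boundedness of the inclusion stated through real bounds on the norms, which
    removes the inclusion map, the extended reals and negative constants from
    the later arguments; finiteness of the target norm is part of it. *)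
Lemma continuous_embeddingP {R : realType} (d : nat) (p1 p2 : R)
    (phi1 phi2 : R -> R) : phi1 1 = 1 ->
  continuous_embedding d phi1 phi2 p1 p2 <->
  exists2 C : R, 0 <= C & forall (lam : 'rV[int]_d -> R[i]) (M : R),
    (mnorm phi1 p1 lam <= M%:E)%E -> (mnorm phi2 p2 lam <= (C * M)%:E)%E.
Proof.
move=> phi1_1.
have mnorm0 lam : (0 <= @mnorm R d phi1 p1 lam)%E by rewrite mnorm_ge0// phi1_1.
split=> [[sub [C hC]]|[C C0 hC]].
  exists `|C| => [//|lam M lamM].
  have lam1 : mspace phi1 p1 lam by exact: le_lt_trans lamM (ltry _).
  have le1 := hC (SigSub (mem_set lam1)).
  apply: (@le_trans _ _ (C%:E * mnorm phi1 p1 lam)%E); first exact: le1.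
  rewrite EFinM; apply: (@le_trans _ _ (`|C|%:E * mnorm phi1 p1 lam)%E).
    by apply: lee_wpmul2r => //; rewrite lee_fin ler_norm.
  by apply: lee_wpmul2l => //; rewrite lee_fin.
have key lam : mspace phi1 p1 lam ->
    (mnorm phi2 p2 lam <= C%:E * @mnorm R d phi1 p1 lam)%E.
  move=> lam1; have lam_fin : mnorm phi1 p1 lam \is a fin_num.
    by rewrite ge0_fin_numE.
  by rewrite -(fineK lam_fin) -EFinM; apply: hC; rewrite fineK.
have sub : mspace phi1 p1 `<=` @mspace R d phi2 p2.
  move=> lam lam1; apply: le_lt_trans (key _ lam1) _.
  by rewrite lte_mul_pinfty// ?lee_fin.
by exists sub, C => x; apply: key; exact: (set_mem (valP x)).
Qed.

(** * The growth condition suffices *)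

(** In both cases the mean of exponent [p2] over a cube of side [2 ^ j] is at
    most [N / phi1 (2 ^ j) ^ rho], with [rho = min 1 (p1 / p2)]. *)
Lemma mnorm_embedding {R : realType} (d : nat) (p1 p2 C : R)
    (phi1 phi2 : R -> R) (lam : 'rV[int]_d -> R[i]) (N : R) :
  0 < p1 -> 0 < p2 -> classG d p1 phi1 -> classG d p2 phi2 -> phi1 1 = 1 ->
  (forall j, phi2 (2 ^+ j) <= C * phi1 (2 ^+ j) `^ Num.min 1 (p1 / p2)) ->
  (mnorm phi1 p1 lam <= N%:E)%E -> (mnorm phi2 p2 lam <= (C * N)%:E)%E.
Proof.
move=> p1_gt0 p2_gt0 phi1G phi2G phi1_1 hC lamN.
have lam_le k : Normc.normc (lam k) <= N.
  by rewrite -lee_fin (le_trans _ lamN)// normc_le_mnorm.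
have N0 : 0 <= N by exact: le_trans (normc_ge0 _) (lam_le 0).
have phi1_gt0 j : 0 < phi1 (2 ^+ j) by exact: classG_gt0 phi1G j.
have C0 : 0 <= C.
  have := hC 0%N; rewrite phi1_1 powR1 mulr1.
  by apply: le_trans; exact: ltW (classG_gt0 phi2G 0%N).
move: lamN; rewrite !mnorm_leP => lamN j m; have {}lamN := lamN j m.
have mean1 : cell_mean p1 lam j m <= N / phi1 (2 ^+ j).
  by rewrite ler_pdivlMr// mulrC.
set r := Num.min 1 _ in hC.
have mean2 : cell_mean p2 lam j m <= N / phi1 (2 ^+ j) `^ r.
  rewrite /r; have [p21|p12] := leP 1 (p1 / p2).
    rewrite powRr1; last exact: ltW.
    apply: le_trans mean1.
    by apply: pmean_le_exponent => //; rewrite -[p2]mul1r -ler_pdivlMr.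
  have p12' : p1 < p2 by rewrite -[p2]mul1r -ltr_pdivrMr.
  have /= := @pmean_interpolation _ _ p1 p2 N
    (fun t => Normc.normc (lam (cell j m t))) p1_gt0 p12' _.
  move=> /(_ (fun t => introT andP (conj (normc_ge0 _) (lam_le _))))/le_trans.
  apply; apply: (@le_trans _ _
    (N `^ (1 - p1 / p2) * (N / phi1 (2 ^+ j)) `^ (p1 / p2))).
    apply: ler_wpM2l; first exact: powR_ge0.
    apply: ge0_ler_powR => //; first by rewrite divr_ge0 ?ltW.
      by rewrite nnegrE pmean_ge0.
    by rewrite nnegrE divr_ge0// ltW.
  rewrite powRM ?invr_ge0 ?(ltW (phi1_gt0 _))// powRV// mulrA -powRD.
    by rewrite subrK powRr1.
  by rewrite subrK oner_eq0.
apply: (@le_trans _ _ (C * phi1 (2 ^+ j) `^ r * (N / phi1 (2 ^+ j) `^ r))).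
  by apply: ler_pM => //; [exact: ltW (classG_gt0 phi2G j)|exact: pmean_ge0].
rewrite -mulrA ler_wpM2l// mulrCA divff ?mulr1//.
by rewrite gt_eqF// powR_gt0.
Qed.

(** * Combs *)

(** The comb of spacing [2 ^ s] in [Q_{-j,m}]. *)
Definition in_comb {d : nat} (s j : nat) (m k : 'rV[int]_d) : bool :=
  [exists t, cell j m t == k] && [forall i, (2 ^+ s %| k ord0 i)%Z].

(** A position [t] in [Q_{-J,M}] whose point lies on the comb is determined by
    the quotient of its residue modulo [2 ^ j] by [2 ^ s]: the residue of [t]
    modulo [2 ^ s] is fixed by divisibility, and points of [Q_{-j,m}] are
    separated by their residues modulo [2 ^ j].  This one encoding serves small
    cubes ([J <= s], at most one point), intermediate ones, and cubes larger
    than the support of the comb. *)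
Lemma card_comb_le {d : nat} (s j J : nat) (m M : 'rV[int]_d) : (s <= j)%N ->
  (#|[pred t | in_comb s j m (cell J M t)]| <= (2 ^ (minn J j - s)) ^ d)%N.
Proof.
move=> sj; rewrite -(card_cell d (2 ^ (minn J j - s))).
have lt_q (t : 'I_(2 ^ J)) : ((t %% 2 ^ j) %/ 2 ^ s < 2 ^ (minn J j - s))%N.
  rewrite ltn_divLR ?expn_gt0// -expnD.
  apply: (@leq_trans (2 ^ minn J j)); last by rewrite leq_exp2l//; lia.
  rewrite /minn; case: ifP => _; last by rewrite ltn_mod expn_gt0.
  by apply: leq_ltn_trans (ltn_ord t); exact: leq_mod.
pose q (t : {ffun 'I_d -> 'I_(2 ^ J)}) := [ffun i => Ordinal (lt_q (t i))].
apply: (@leq_card_in _ _ q) => t t'.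
rewrite !inE /in_comb => /andP[/existsP[u /eqP eu] /forallP tdiv].
move=> /andP[/existsP[u' /eqP eu'] /forallP t'div] /ffunP qE.
apply: (@cell_inj d J M); apply/rowP => i.
have /eqP := congr1 val (qE i); rewrite !ffunE /= => /eqP q_eq.
have t_s : (t i = t' i %[mod 2 ^ s])%N.
  apply/eqP; rewrite -eqz_nat -!modz_nat eqz_mod_dvd.
  have -> : (t i)%:Z - (t' i)%:Z = cell J M t ord0 i - cell J M t' ord0 i.
    by rewrite !mxE opprD addrACA subrr add0r.
  by rewrite -natz natrX rpredB ?tdiv ?t'div.
have t_j : (t i = t' i %[mod 2 ^ j])%N.
  rewrite (divn_eq (t i %% 2 ^ j) (2 ^ s)) (divn_eq (t' i %% 2 ^ j) (2 ^ s)).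
  by rewrite q_eq !modn_dvdm ?t_s// dvdn_exp2l.
(* Residues modulo [2 ^ j] separate the points of a cell of side [2 ^ j]. *)
have k_lo := proj1 (cellP j m _) (ex_intro _ u eu) i.
have k'_lo := proj1 (cellP j m _) (ex_intro _ u' eu') i.
move: k_lo k'_lo; rewrite !mxE.
have -> : (2 ^+ j : int) = (2 ^ j)%N by rewrite -natrX natz.
rewrite (divn_eq (t i) (2 ^ j)) (divn_eq (t' i) (2 ^ j)) t_j.
move: (t i %/ _)%N (t' i %/ _)%N => a b; rewrite !PoszD !PoszM.
have := expn_gt0 2 j; move: (2 ^ j)%N (2 ^+ J) => n N n0.
move=> /andP[l1 u1] /andP[l2 u2].
move: (m ord0 i) (M ord0 i) l1 u1 l2 u2 => y x l1 u1 l2 u2.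
clear - l1 u1 l2 u2.
have le_mul (c e : nat) : (c < e)%N -> (c%:Z + 1) * n%:Z <= e%:Z * n%:Z.
  by move=> ce; rewrite ler_wpM2r// lezD1 ltz_nat.
case: (ltngtP a b) => [/le_mul|/le_mul|->//]; lia.
Qed.

Lemma card_comb_ge {d : nat} (s j : nat) (m : 'rV[int]_d) : (s <= j)%N ->
  ((2 ^ (j - s)) ^ d <= #|[pred t | in_comb s j m (cell j m t)]|)%N.
Proof.
move=> sj; rewrite -(card_cell d (2 ^ (j - s))).
have lt_q (t : 'I_(2 ^ (j - s))) : (t * 2 ^ s < 2 ^ j)%N.
  by rewrite -[X in (_ < 2 ^ X)%N](subnK sj) expnD ltn_pmul2r ?expn_gt0.
pose q (t : {ffun 'I_d -> 'I_(2 ^ (j - s))}) := [ffun i => Ordinal (lt_q (t i))].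
have q_inj : injective q.
  move=> t t' /ffunP e; apply/ffunP => i; apply: val_inj.
  by have /(congr1 val)/eqP := e i; rewrite !ffunE/= eqn_pmul2r ?expn_gt0// => /eqP.
rewrite -(card_codom q_inj); apply: subset_leq_card.
apply/fintype.subsetP => _ /codomP[t ->]; rewrite inE /in_comb.
apply/andP; split; first by apply/existsP; exists (q t).
apply/forallP => i; rewrite mxE ffunE /= -[in X in _ * X](subnK sj) exprD.
have -> : (t i * 2 ^ s)%N%:Z = (t i)%:Z * 2 ^+ s by rewrite PoszM -natrX natz.
by rewrite mulrA rpredD// dvdz_mull.
Qed.

Definition comb {R : realType} {d : nat} (s j : nat) (m : 'rV[int]_d) :
  'rV[int]_d -> R[i] := fun k => if in_comb s j m k then 1 else 0.

Lemma cell_mean_comb {R : realType} {d : nat} (p : R) (s j J : nat)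
    (m M : 'rV[int]_d) : 0 < p ->
  cell_mean p (comb s j m) J M =
  #|[pred t | in_comb s j m (cell J M t)]|%:R `^ p^-1 / volroot d p J.
Proof.
move=> p0; rewrite /cell_mean /pmean card_cell.
have -> : \sum_t Normc.normc (comb s j m (cell J M t) : R[i]) `^ p =
    #|[pred t | in_comb s j m (cell J M t)]|%:R.
  rewrite -sum1_card natr_sum [RHS]big_mkcond; apply: eq_bigr => t _.
  rewrite inE /comb; case: in_comb.
    by rewrite Normc.normc1 powR1.
  by rewrite Normc.normc0 powR0// gt_eqF.
by rewrite powRM ?invr_ge0// mulrC powRV ?volrootE// ltr0n !expn_gt0.
Qed.

(** On cubes of side at most [2 ^ s] the comb is a single spike, and
    [phi (2 ^ J) <= 2 ^ (J d / p)] gives the bound 1.  Between the sides [2 ^ s]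
    and [2 ^ j] the comb has constant density, so the monotonicity of [phi]
    makes [J = j] the worst case.  On larger cubes the number of points stays
    constant, and the growth of the volume offsets that of [phi]. *)
Lemma mnorm_comb_le {R : realType} {d : nat} (p : R) (phi : R -> R) (s j : nat)
    (m : 'rV[int]_d) : 0 < p -> classG d p phi -> phi 1 = 1 -> (s <= j)%N ->
  (mnorm phi p (comb s j m) <=
   (Num.max 1 (phi (2 ^+ j) / volroot d p s))%:E)%E.
Proof.
move=> p0 phiG phi1 sj; apply/mnorm_leP => J M.
have phi_gt0 i : 0 < phi (2 ^+ i) by exact: classG_gt0 phiG i.
rewrite cell_mean_comb//.
have card_le : (#|[pred t | in_comb s j m (cell J M t)]|%:R : R) `^ p^-1
    <= volroot d p (minn J j - s).
  rewrite volrootE; apply: ge0_ler_powR; rewrite ?nnegrE ?invr_ge0 ?(ltW p0)//.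
  by rewrite ler_nat card_comb_le.
apply: (@le_trans _ _
    (phi (2 ^+ J) * (volroot d p (minn J j - s) / volroot d p J))).
  apply: ler_wpM2l; first exact: ltW.
  by apply: ler_wpM2r; rewrite ?invr_ge0 ?(ltW (volroot_gt0 _ _ _)).
have [Js|sJ] := leqP J s.
  rewrite le_max; apply/orP; left.
  rewrite (minn_idPl (leq_trans Js sj)) (eqP Js) volroot0 mul1r.
  rewrite ler_pdivrMr ?volroot_gt0// mul1r.
  have := classG_volroot phiG (leq0n J).
  by rewrite phi1 mul1r subn0.
rewrite le_max; apply/orP; right.
have v0 i : volroot d p i != 0 by rewrite gt_eqF// volroot_gt0.
have [Jj|jJ] := leqP J j.
  rewrite volroot_subn 1?ltnW// mulrAC divff// mul1r.
  by apply: ler_wpM2r; rewrite ?invr_ge0 ?(ltW (volroot_gt0 _ _ _))// (classG_le phiG).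
rewrite volroot_subn//.
have -> : volroot d p j / volroot d p s / volroot d p J =
    (volroot d p (J - j))^-1 / volroot d p s.
  by rewrite volroot_subn 1?ltnW//; field; rewrite !v0.
rewrite mulrA; apply: ler_wpM2r; first by rewrite invr_ge0 ltW// volroot_gt0.
rewrite ler_pdivrMr ?volroot_gt0//.
by apply: (classG_volroot phiG); exact: ltnW.
Qed.

Lemma mnorm_comb_ge {R : realType} {d : nat} (p : R) (phi : R -> R) (s j : nat)
    (m : 'rV[int]_d) : 0 < p -> classG d p phi -> (s <= j)%N ->
  ((phi (2 ^+ j) / volroot d p s)%:E <= mnorm phi p (comb s j m))%E.
Proof.
move=> p0 phiG sj; apply: le_trans (mnorm_ge phi p _ j m).
rewrite lee_fin; apply: ler_wpM2l; first exact: ltW (classG_gt0 phiG j).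
rewrite cell_mean_comb// ler_pdivlMr ?volroot_gt0// mulrC -volroot_subn//.
rewrite volrootE; apply: ge0_ler_powR; rewrite ?nnegrE ?invr_ge0 ?(ltW p0)//.
by rewrite ler_nat card_comb_ge.
Qed.

(** * The growth condition is necessary *)

(** The factor [volroot d p2 1] is the price of rounding the spacing of the comb
    to a power of 2. *)
Lemma growth_of_embedding {R : realType} (d : nat) (p1 p2 C : R)
    (phi1 phi2 : R -> R) :
  0 < p1 -> 0 < p2 -> classG d p1 phi1 -> classG d p2 phi2 -> phi1 1 = 1 ->
  0 <= C ->
  (forall (lam : 'rV[int]_d -> R[i]) (M : R),
    (mnorm phi1 p1 lam <= M%:E)%E -> (mnorm phi2 p2 lam <= (C * M)%:E)%E) ->
  forall j, phi2 (2 ^+ j) <=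
    C * volroot d p2 1 * phi1 (2 ^+ j) `^ Num.min 1 (p1 / p2).
Proof.
move=> p1_gt0 p2_gt0 phi1G phi2G phi1_1 C0 hC j.
have phi1_ge1 : 1 <= phi1 (2 ^+ j) by exact: classG_ge1 phi1G j phi1_1.
have test s : (s <= j)%N -> phi2 (2 ^+ j) / volroot d p2 s <=
    C * Num.max 1 (phi1 (2 ^+ j) / volroot d p1 s).
  move=> sj; rewrite -lee_fin.
  apply: (le_trans (mnorm_comb_ge p2 phi2 s j (0 : 'rV[int]_d) _ _ _)) => //.
  by apply: hC; exact: mnorm_comb_le.
have [p21|p12] := leP 1 (p1 / p2).
  have := test 0%N (leq0n j); rewrite !volroot0 !divr1 (max_idPr phi1_ge1).
  move/le_trans; apply; rewrite powRr1 ?(le_trans ler01)// -mulrA.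
  by rewrite ler_wpM2l// ler_peMl ?(le_trans ler01)// volroot_ge1.
(* The least [s] gives the densest comb of norm at most 1 in the source; the
   spacing [2 ^ s.-1], if smaller, is already too dense. *)
have ex_s : exists s, phi1 (2 ^+ j) <= volroot d p1 s.
  exists j; have := classG_volroot phi1G (leq0n j).
  by rewrite phi1_1 mul1r subn0.
case: (ex_minnP ex_s) => s s_ge s_min.
have sj : (s <= j)%N.
  apply: s_min; have := classG_volroot phi1G (leq0n j).
  by rewrite phi1_1 mul1r subn0.
have := test s sj; rewrite (max_idPl _); last first.
  by rewrite ler_pdivrMr ?volroot_gt0// mul1r.
rewrite mulr1 ler_pdivrMr ?volroot_gt0// => /le_trans; apply.
rewrite -mulrA ler_wpM2l//.
apply: (@le_trans _ _ (volroot d p2 1 * volroot d p2 s.-1)).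
  by case: (s) => [|n]; rewrite ?volroot0 ?mulr1 ?volroot_ge1// -volrootD.
rewrite ler_wpM2l ?(ltW (volroot_gt0 _ _ _))// (volroot_powR _ p1)//.
apply: ge0_ler_powR; rewrite ?divr_ge0 ?(ltW p1_gt0) ?(ltW p2_gt0) ?nnegrE//.
- by rewrite ltW// volroot_gt0.
- by rewrite (le_trans ler01).
case: (s) s_min => [|n] s_min; first by rewrite volroot0.
by rewrite leNgt; apply/negP => /ltW /s_min; rewrite ltnn.
Qed.

(** * Failure of compactness *)

Lemma comb00E {R : realType} {d : nat} (m k : 'rV[int]_d) :
  comb 0 0 m k = (if k == m then 1 else 0) :> R[i].
Proof.
rewrite /comb /in_comb; congr (if _ then _ else _).
apply/andP/eqP => [[/existsP[t /eqP <-] _]|->]; first by rewrite cell0.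
split; last by apply/forallP => i; rewrite expr0 dvd1z.
by apply/existsP; exists [ffun=> ord0]; rewrite cell0.
Qed.

Lemma normc_distD {R : realType} (a b c : R[i]) :
  Normc.normc (a - c) <= Normc.normc (a - b) + Normc.normc (b - c).
Proof. by have := le_normcD (a - b) (b - c); rewrite addrA subrK. Qed.

Lemma normc_distC {R : realType} (a b : R[i]) :
  Normc.normc (a - b) = Normc.normc (b - a).
Proof. by rewrite -(normcN (a - b)) opprB. Qed.

(** Balls of the quasi-norm need not be open, and showing directly that they are
    neighbourhoods takes a quasi-triangle inequality.  The supremum distance
    satisfies the triangle inequality and is dominated by the quasi-norm, so
    its balls are open.  The bound [e < r] uniform in [k] leaves room for a small
    quasi-norm ball around each point. *)
Lemma nbhs_sup_ball {R : realType} {d : nat} (phi : R -> R) (p r : R)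
    (x : @mseq R d phi p) : 0 < p -> phi 1 = 1 -> 0 < r ->
  nbhs x [set y : mseq phi p |
    exists2 e, e < r & forall k, Normc.normc (\val y k - \val x k) <= e].
Proof.
move=> p0 phi1 r0; apply: open_nbhs_nbhs; split; last first.
  by exists 0 => // k; rewrite subrr Normc.normc0.
move=> y [e er yx]; exists ((r - e) / 2) => [|z zy].
  by rewrite divr_gt0// subr_gt0.
exists (e + (r - e) / 2) => [|k]; first by lra.
rewrite [leRHS]addrC; apply: le_trans (normc_distD _ (\val y k) _) _.
apply: lerD (yx k); rewrite -lee_fin ltW//; apply: le_lt_trans zy.
exact: (normc_le_mnorm phi p (\val z - \val y)%R).
Qed.

(** A cluster point of the unit sequences would have two distinct ones within
    supremum distance less than 1/2, hence less than 1 apart. *)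
Lemma not_compact_embedding {R : realType} (d : nat) (p1 p2 : R)
    (phi1 phi2 : R -> R) : (1 <= d)%N ->
  0 < p1 -> 0 < p2 -> classG d p1 phi1 -> phi1 1 = 1 -> phi2 1 = 1 ->
  ~ compact_embedding d phi1 phi2 p1 p2.
Proof.
move=> d_ge1 p1_gt0 p2_gt0 phi1G phi1_1 phi2_1 [sub].
rewrite precompactE => cpt.
pose c n : 'rV[int]_d := const_mx n%:Z.
have e_le n : (mnorm phi1 p1 (comb 0 0 (c n)) <= 1%:E)%E.
  have := mnorm_comb_le p1 phi1 0 0 (c n) p1_gt0 phi1G phi1_1 (leqnn 0).
  by rewrite phi1_1 volroot0 divr1 maxxx.
have e_in n : mspace phi1 p1 (comb 0 0 (c n)).
  by exact: le_lt_trans (e_le n) (ltry _).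
pose e n : mseq phi1 p1 := SigSub (mem_set (e_in n)).
pose u n := minclusion sub (e n).
have uE n k : \val (u n) k = if k == c n then 1 else 0 by exact: comb00E.
have : (u @ \oo) (closure (minclusion sub @` [set x | (mseq_norm x <= 1)%E])).
  by exists 0%N => // n _; apply: subset_closure; exists (e n) => //; exact: e_le.
move=> /(cpt (u @ \oo) _)[x [_ xu]].
have V := nbhs_sup_ball phi2 p2 2^-1 x p2_gt0 phi2_1.
have /V{}V : (0 : R) < 2^-1 by rewrite invr_gt0.
have far N : exists2 n, (N < n)%N & forall k,
    Normc.normc (\val (u n) k - \val x k) < 2^-1.
  have uN : (u @ \oo) [set u n | n in [set n | (N < n)%N]].
    by exists N.+1 => // n /= Nn; exists n.
  have [_ [[n Nn <-] [r r2 ur]]] := xu _ _ uN V.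
  by exists n => // k; exact: le_lt_trans (ur k) r2.
have [n _ un] := far 0%N; have [n' nn' un'] := far n.
have : Normc.normc (\val (u n) (c n) - \val (u n') (c n)) < 1.
  apply: le_lt_trans (normc_distD _ (\val x (c n)) _) _.
  rewrite [ltRHS](_ : 1 = 2^-1 + 2^-1); last by lra.
  by apply: ltrD; [exact: un|rewrite normc_distC; exact: un'].
rewrite !uE eqxx [c n == c n'](_ : _ = false) ?subr0 ?Normc.normc1 ?ltxx//.
apply/negP => /eqP/rowP/(_ (Ordinal d_ge1)); rewrite !mxE => -[nn'E].
by rewrite nn'E ltnn in nn'.
Qed.

(** * The embedding theorem *)

Theorem theorem3p1 (R : realType) (d : nat) (p1 p2 : R) (phi1 phi2 : R -> R)
  (d_ge1 : (1 <= d)%N) (p1_gt0 : 0 < p1) (p2_gt0 : 0 < p2)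
  (phi1_G : classG d p1 phi1) (phi2_G : classG d p2 phi2)
  (phi1_1 : phi1 1 = 1) (phi2_1 : phi2 1 = 1)
  (phi1_unbounded :
     ereal_sup [set (phi1 (2 ^+ k))%:E | k in [set: nat]] = +oo%E)
  (phi2_unbounded :
     ereal_sup [set (phi2 (2 ^+ k))%:E | k in [set: nat]] = +oo%E) :
  (continuous_embedding d phi1 phi2 p1 p2 <->
   (ereal_sup [set (phi2 (2 ^+ j) / phi1 (2 ^+ j) `^ Num.min 1 (p1 / p2))%:E
              | j in [set: nat]] < +oo)%E) /\
  ~ compact_embedding d phi1 phi2 p1 p2.
Proof.
split; last exact: not_compact_embedding.
have phi1r_gt0 j : 0 < phi1 (2 ^+ j) `^ Num.min 1 (p1 / p2).
  by rewrite powR_gt0// (classG_gt0 phi1_G).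
rewrite continuous_embeddingP//; split=> [[C C0 hC]|].
  apply: (@le_lt_trans _ _ (C * volroot d p2 1)%:E); last exact: ltry.
  apply: ge_ereal_sup => _ [j _ <-].
  by rewrite lee_fin ler_pdivrMr//; exact: growth_of_embedding hC j.
set S := ereal_sup _ => S_lty.
have ratio_le j :
    ((phi2 (2 ^+ j) / phi1 (2 ^+ j) `^ Num.min 1 (p1 / p2))%:E <= S)%E.
  by apply: ereal_sup_ubound; exists j.
have S_fin : S \is a fin_num.
  rewrite ge0_fin_numE//; apply: le_trans (ratio_le 0%N).
  by rewrite lee_fin phi1_1 phi2_1 powR1 divr1.
have growth j : phi2 (2 ^+ j) <= fine S * phi1 (2 ^+ j) `^ Num.min 1 (p1 / p2).
  by rewrite -ler_pdivrMr// -lee_fin fineK.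
exists (fine S) => [|lam N]; last exact: mnorm_embedding.
by have := growth 0%N; rewrite phi1_1 phi2_1 powR1 mulr1; exact: le_trans.
Qed.
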